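(* Let $N\ge1$ and consider the multiparticle model $(T,I,N)$ with any initial condition $I$. If some particle in the model has an unbounded past, then some (possibly different) particle in the model has an unbounded future. Likewise, if some particle has an unbounded future, then some (possibly different) particle has an unbounded past.
   Context: **Lattice.** $T=(\mathbb{T},\mathbb{B})$ is the triangular lattice with sites $\mathbb{T}=\{a(1,0)+b(1/2,\sqrt3/2):a,b\in\mathbb{Z}\}\subset\mathbb{R}^2$; its bonds $\mathbb{B}$ are the unit segments joining sites at distance $1$ (each site has six neighbors). **Multiparticle model $(T,I,N)$, unit speed.** There are $N\ge1$ particles $p_1,\dots,p_N$ moving along bonds with unit speed. Particle $p_i$ has position $\mathbf{r}_i(\cdot)\in\mathbb{R}^2$, velocity $\mathbf{v}_i(\cdot)\in\mathbb{R}^2$ (a unit vector in one of the six bond directions), and displacement $\triangle t_i$, where $0=\triangle t_1<\triangle t_2<\dots<\triangle t_N<1$; set $\triangle t_{N+1}=1$, so that time $t+\triangle t_{N+1}$ is time $(t+1)+\triangle t_1$. Particle $p_i$ is at a lattice site exactly at the times $t+\triangle t_i$, $t$ an integer. Every site $\mathbf{h}\in\mathbb{T}$ carries a scatterer with orientation $C(s,\mathbf{h})\in\{-1,1\}$ at time $s$ ($-1$: left rotator; $1$: right rotator). An initial condition is $I=(\bar{\mathbf{r}},\bar{\mathbf{v}},C)$, with $\bar{\mathbf r}=(\mathbf r_1,\dots,\mathbf r_N)$ and $\bar{\mathbf v}=(\mathbf v_1,\dots,\mathbf v_N)$ the positions and velocities at time $0$ (with $\mathbf{r}_i+\triangle t_i\mathbf{v}_i\in\mathbb{T}$)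 and $C=C(0,\cdot)$ the configuration at time $0$. Here $\mathbf{v}_i(t+\triangle t_i)$ and $C(t+\triangle t_i,\cdot)$ denote values just before $p_i$ is scattered at that time. For integers $t$ and $1\le i\le N$, $1\le j\le N$ the dynamics are: - $\mathbf{v}_i(t+\triangle t_{j+1})=R[C(t+\triangle t_i,\mathbf{r}_i(t+\triangle t_i))]\,\mathbf{v}_i(t+\triangle t_i)$ if $j=i$, and $=\mathbf{v}_i(t+\triangle t_j)$ otherwise; - $\mathbf{r}_i(t+\triangle t_{j+1})=\mathbf{r}_i(t+\triangle t_j)+(\triangle t_{j+1}-\triangle t_j)\,\mathbf{v}_i(t+\triangle t_{j+1})$; - $C(t+\triangle t_{j+1},\mathbf{h})=-C(t+\triangle t_j,\mathbf{h})$ if $\mathbf{h}=\mathbf{r}_j(t+\triangle t_j)$, and $=C(t+\triangle t_j,\mathbf{h})$ otherwise; where $R[z]=\begin{pmatrix}\cos(2\pi z/3)&\sin(2\pi z/3)\\-\sin(2\pi z/3)&\cos(2\pi z/3)\end{pmatrix}$ for $z\in\{-1,1\}$. Thus a particle arriving at a left (right) rotator has its velocity rotated by $2\pi/3$ to its left (right), and the rotator then flips orientation; particles do not otherwise interact. Positions at all real times are given by linear motion between these times. **Negative times.** Each forward step is invertible, so the state at time $0$ determines a unique two-sided evolution satisfying the equations above for all $t\in\mathbb{Z}$; the state at negative times is this backward evolution. **Unbounded past/future.** A particle has an unbounded future (past) if there is no bounded (finite) subset $\Omega$ of the lattice in which it remains for all $t\ge0$ (for all $t\le0$). *)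

(* Defs.v *)
From HB Require Import structures.
From mathcomp Require Import all_boot all_order all_algebra.
From mathcomp Require Import boolp classical_sets functions cardinality reals.
From mathcomp Require Import trigo.

Set Implicit Arguments.
Unset Strict Implicit.
Unset Printing Implicit Defensive.

Import Order.TTheory GRing.Theory Num.Theory.

Local Open Scope classical_set_scope.
Local Open Scope ring_scope.

Section Lattice.
Variable R : realType.

Definition vec2 (x y : R) : 'cV[R]_2 := \col_(i < 2) (if i == 0 then x else y).

Definition edist (x y : 'cV[R]_2) : R :=
  Num.sqrt (\sum_(i < 2) (x i 0 - y i 0) ^+ 2).

Definition sites : set 'cV[R]_2 :=
  [set h | exists a b : int,
     h = a%:~R *: vec2 1 0 + b%:~R *: vec2 (1 / 2) (Num.sqrt 3 / 2)].

Definition bonded (x y : 'cV[R]_2) : Prop :=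
  [/\ sites x, sites y & edist x y = 1].

Definition segment (x y : 'cV[R]_2) : set 'cV[R]_2 :=
  [set x + l *: (y - x) | l in [set l : R | 0 <= l <= 1]].

(* The six unit vectors along the bonds. *)
Definition bond_direction (v : 'cV[R]_2) : Prop :=
  exists x y, bonded x y /\ v = y - x.

(* Points of the plane lying on a bond whose two endpoints belong to O. *)
Definition carrier (O : set 'cV[R]_2) : set 'cV[R]_2 :=
  [set p | exists x y, [/\ O x, O y, bonded x y & segment x y p]].

(* Clockwise rotation by 2 pi z / 3: z = 1 turns right, z = -1 turns left. *)
Definition rot (z : int) : 'M[R]_2 :=
  let a := 2 * pi * z%:~R / 3 in
  \matrix_(i < 2, j < 2)
    (if i == j then cos a else if i == 0 then sin a else - sin a).

End Lattice.

Section Model.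
Variables (R : realType) (N : nat).

(* Indices are shifted by one: dt 0, ..., dt (N - 1) are the displacements of
   the N particles, and the last entry is the conventional value 1, so that
   t + dt N = (t + 1) + dt 0. *)
Definition displacements (dt : 'I_N.+1 -> R) : Prop :=
  [/\ dt ord0 = 0, (forall i j : 'I_N.+1, (i < j)%N -> dt i < dt j)
    & dt ord_max = 1].

Definition disp (dt : 'I_N.+1 -> R) (j : 'I_N) : R :=
  dt (widen_ord (leqnSn N) j).

Definition disp_next (dt : 'I_N.+1 -> R) (j : 'I_N) : R := dt (lift ord0 j).

Record initial_condition := InitialCondition {
  pos0 : 'I_N -> 'cV[R]_2;
  vel0 : 'I_N -> 'cV[R]_2;
  conf0 : 'cV[R]_2 -> int
}.

Definition admissible (dt : 'I_N.+1 -> R) (I : initial_condition) : Prop :=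
  [/\ forall i, bond_direction (vel0 I i),
      forall i, sites (pos0 I i + disp dt i *: vel0 I i)
    & forall h, sites h -> conf0 I h = -1 \/ conf0 I h = 1].

(* Only the values of vel and conf at the scattering times t + dt j, and of
   conf at lattice sites, are meaningful; they are the values just before the
   scattering taking place at that time. *)
Record motion := Motion {
  pos : 'I_N -> R -> 'cV[R]_2;
  vel : 'I_N -> R -> 'cV[R]_2;
  conf : R -> 'cV[R]_2 -> int
}.

Definition starts_at (I : initial_condition) (M : motion) : Prop :=
  [/\ forall i, pos M i 0 = pos0 I i,
      forall i, vel M i 0 = vel0 I i
    & forall h, sites h -> conf M 0 h = conf0 I h].

Definition evolves (dt : 'I_N.+1 -> R) (M : motion) : Prop :=
  forall (t : int) (j : 'I_N),
    let s := t%:~R + disp dt j in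
    let s' := t%:~R + disp_next dt j in
    [/\ forall i, vel M i s' =
          if j == i then rot R (conf M s (pos M i s)) *m vel M i s
          else vel M i s,
        forall i, pos M i s' =
          pos M i s + (disp_next dt j - disp dt j) *: vel M i s',
        forall h, sites h -> conf M s' h =
          if h == pos M j s then - conf M s h else conf M s h
      & forall i u, s <= u <= s' ->
          pos M i u = pos M i s + (u - s) *: vel M i s'].

(* Between scattering times a particle lies in the interior of a bond, so
   being in a finite set of sites O at an arbitrary real time means lying on
   a bond between two sites of O. *)
Definition unbounded_future (M : motion) (i : 'I_N) : Prop :=
  ~ exists O : set 'cV[R]_2, [/\ O `<=` @sites R, finite_set O
      & forall s : R, 0 <= s -> carrier O (pos M i s)].

Definition unbounded_past (M : motion) (i : 'I_N) : Prop :=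
  ~ exists O : set 'cV[R]_2, [/\ O `<=` @sites R, finite_set O
      & forall s : R, s <= 0 -> carrier O (pos M i s)].

End Model.

(* Main.v *)
(* If every particle has a bounded future, then all particles stay over one
   finite set of sites, and scatterers off that set never flip. The system thus
   visits finitely many states at the times t = 0, 1, 2, ..., so some state
   recurs. Since the dynamics is deterministic in both time directions, the
   whole motion is then periodic over the entire real line, and a finite set
   carrying a particle in the future also carries it in the past. The other
   direction is symmetric. *)

Require Import Defs.
From mathcomp Require Import all_boot all_order all_algebra.
From mathcomp Require Import boolp classical_sets cardinality reals trigo.
From mathcomp Require Import zify ring lra.

Set Implicit Arguments.
Unset Strict Implicit.
Unset Printing Implicit Defensive.

Import Order.TTheory GRing.Theory Num.Theory.

Local Open Scope classical_set_scope.
Local Open Scope ring_scope.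

(* [seq.rot] shadows the rotation matrix. *)
Local Notation rot := Defs.rot.

(** * Finite encodings and the pigeonhole principle *)

Lemma inord_index_inj (T : eqType) (s : seq T) (x y : T) :
  x \in s -> y \in s ->
  inord (index x s) = inord (index y s) :> 'I_(size s).+1 -> x = y.
Proof.
move=> xs ys /(congr1 val); rewrite /= !inordK ?ltnS ?index_size// => xy.
by rewrite -(nth_index x xs) xy nth_index.
Qed.

Lemma pigeonhole (T : finType) (g : nat -> T) : exists m n, m <> n /\ g m = g n.
Proof.
apply: contrapT => g_inj.
suff /leq_card : injective (fun m : 'I_#|T|.+1 => g m) by rewrite card_ord ltnn.
move=> m n gmn; apply: val_inj; apply: contrapT => mn.
by apply: g_inj; exists m, n.
Qed.

(** * The triangular lattice in integer coordinates *)

Section TriangularLattice.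
Variable R : realType.
Implicit Types (x y v : 'cV[R]_2) (a b c d l : R).

(** As cos pi = -1, the triple-angle formula makes c = cos (pi / 3) a root of 4c^3 - 3c + 1 = (c +
    1)(2c - 1)^2. Positivity of c leaves c = 1/2, and doubling the angle concludes. *)
Lemma cos_third_turn : cos (2 * pi / 3 : R) = - (1 / 2).
Proof.
pose c : R := cos (pi / 3); pose s : R := sin (pi / 3).
have c_gt0 : 0 < c.
  by apply: cos_gt0_pihalf; have := @pi_gt0 R; lra.
have sE : s ^+ 2 = 1 - c ^+ 2 by rewrite /s sin2cos2.
have pi3E : pi / 3 + pi / 3 + pi / 3 = pi :> R by field.
have cubic : cos (pi / 3 + pi / 3 + pi / 3) = - 1 :> R by rewrite pi3E cospi.
rewrite cosD cosD sinD -/c -/s in cubic.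
have fact : (c + 1) * (2 * c - 1) ^+ 2 = 0.
  (* The last summand vanishes by [sE]; with it the equality is a polynomial identity in c and s. *)
  suff -> : (c + 1) * (2 * c - 1) ^+ 2 =
            (c * c - s * s) * c - (s * c + c * s) * s + 1 +
            3 * c * (s ^+ 2 - (1 - c ^+ 2)) by rewrite cubic sE; ring.
  ring.
have cE : c = 1 / 2.
  move/eqP: fact; rewrite mulf_eq0 expf_eq0 /= => /orP[|] /eqP; lra.
have -> : 2 * pi / 3 = pi / 3 + pi / 3 :> R by field.
by rewrite cosD -/c -/s -expr2 -(expr2 s) sE cE; field.
Qed.

Lemma sin_third_turn : sin (2 * pi / 3 : R) = Num.sqrt 3 / 2.
Proof.
have sin_gt0 : 0 < sin (2 * pi / 3 : R).
  by apply: sin_gt0_pi; have := @pi_gt0 R; lra.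
apply/eqP; rewrite -(@eqrXn2 _ 2) ?(ltW sin_gt0) ?divr_ge0 ?sqrtr_ge0//; apply/eqP.
by rewrite sin2cos2 cos_third_turn exprMn sqr_sqrtr; [field|lra].
Qed.

(** The coefficients are real, so that points inside a bond have coordinates too; sites are the
    points with integer ones. *)
Definition lat a b : 'cV[R]_2 :=
  a *: vec2 1 0 + b *: vec2 (1 / 2) (Num.sqrt 3 / 2).

Lemma latE a b i : lat a b i 0 = if i == 0 then a + b / 2 else b * Num.sqrt 3 / 2.
Proof. by rewrite !mxE; case: eqP => _; field. Qed.

Lemma latD a b c d : lat a b + lat c d = lat (a + c) (b + d).
Proof. by rewrite /lat !scalerDl addrACA. Qed.

Lemma latZ l a b : l *: lat a b = lat (l * a) (l * b).
Proof. by rewrite /lat scalerDr !scalerA. Qed.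

Lemma latB a b c d : lat a b - lat c d = lat (a - c) (b - d).
Proof. by rewrite -scaleN1r latZ latD !mulN1r. Qed.

Lemma lat_inj a b c d : lat a b = lat c d -> a = c /\ b = d.
Proof.
move=> /colP eq_lat; have := eq_lat 0; have := eq_lat 1; rewrite !latE /=.
have s3 : Num.sqrt (3 : R) != 0 by rewrite gt_eqF// sqrtr_gt0.
move=> eq_s eq_l; have bd : b = d by apply: (mulIf s3); lra.
by split=> //; move: eq_l; rewrite bd; lra.
Qed.

(** The form x^2 + xy + y^2 is the norm form of the Eisenstein integers. *)
Lemma edist_lat a b c d :
  edist (lat a b) (lat c d) =
  Num.sqrt ((a - c) ^+ 2 + (a - c) * (b - d) + (b - d) ^+ 2).
Proof.
rewrite /edist big_ord_recl big_ord1 !latE /=.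
have /= s3 := @sqr_sqrtr R 3 (ler0n _ 3); congr Num.sqrt.
suff -> : b * Num.sqrt 3 / 2 - d * Num.sqrt 3 / 2 = (b - d) / 2 * Num.sqrt 3.
  by rewrite exprMn s3; field.
by field.
Qed.

Lemma sitesP x : sites x <-> exists a b : int, x = lat a%:~R b%:~R.
Proof. by []. Qed.

Lemma sitesD x y : sites x -> sites y -> sites (x + y).
Proof.
move=> [a [b ->]] [c [d ->]]; apply/sitesP; exists (a + c), (b + d).
by rewrite -!/(lat _ _) latD !rmorphD.
Qed.

Lemma sitesB x y : sites x -> sites y -> sites (x - y).
Proof.
move=> [a [b ->]] [c [d ->]]; apply/sitesP; exists (a - c), (b - d).
by rewrite -!/(lat _ _) latB !rmorphB.
Qed.

Lemma bonded_lat (a b c d : int) :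
  edist (lat a%:~R b%:~R) (lat c%:~R d%:~R) = 1 <->
  (a - c) ^+ 2 + (a - c) * (b - d) + (b - d) ^+ 2 = 1.
Proof.
rewrite edist_lat -!rmorphB -!rmorphXn -rmorphM -!rmorphD /=.
set q := _ + _; split=> [q1|->]; last by rewrite sqrtr1.
(* [Num.sqrt] is 0 on negative reals, so a root equal to 1 forces q to be nonnegative. *)
have q_ge0 : 0 <= (q%:~R : R).
  by rewrite leNgt; apply/negP => /ltW/ler0_sqrtr q0; move: q1; rewrite q0; lra.
have := sqr_sqrtr q_ge0; rewrite q1 expr1n => /esym/eqP.
by rewrite -[1]/(1%:~R) eqr_int => /eqP.
Qed.

Lemma bond_directionP v : bond_direction v <->
  exists a b : int, a ^+ 2 + a * b + b ^+ 2 = 1 /\ v = lat a%:~R b%:~R.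
Proof.
split=> [[x [y [[[a [b ->]] [c [d ->]] /bonded_lat abcd] ->]]]|[a [b [ab ->]]]].
  exists (c - a), (d - b); rewrite -!/(lat _ _) latB !rmorphB; split=> //.
  by rewrite -abcd; ring.
exists (lat 0%:~R 0%:~R), (lat a%:~R b%:~R); split; last by rewrite latB !subr0.
split; [by exists 0, 0|by exists a, b|apply/bonded_lat].
by rewrite -ab; ring.
Qed.

Lemma bond_direction_site v : bond_direction v -> sites v.
Proof. by move=> /bond_directionP[a [b [_ ->]]]; apply/sitesP; exists a, b. Qed.

(** Completing the square, 4(a^2 + ab + b^2) = 3a^2 + (a + 2b)^2, hence 3a^2 <= 4. *)
Lemma unit_norm_coord (a b : int) :
  a ^+ 2 + a * b + b ^+ 2 = 1 -> a \in [:: -1; 0; 1].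
Proof.
rewrite !inE => ab; have := sqr_ge0 (a + 2 * b) => ab2.
have a2E : 3 * (a * a) = 4 * (a ^+ 2 + a * b + b ^+ 2) - (a + 2 * b) ^+ 2 by ring.
have : 3 * (a * a) <= 4 by rewrite a2E ab lerBlDr lerDl.
move=> a2; have : -2 < a < 2 by nia.
lia.
Qed.

(** Nine vectors: a finite list large enough to contain the six bond directions. *)
Definition directions : seq 'cV[R]_2 :=
  [seq lat m%:~R n%:~R | m : int <- [:: -1; 0; 1], n : int <- [:: -1; 0; 1]].

Lemma mem_directions v : bond_direction v -> v \in directions.
Proof.
move=> /bond_directionP[a [b [ab ->]]].
apply: (allpairs_f (fun m n : int => lat m%:~R n%:~R)).
  exact: unit_norm_coord ab.
by apply: (@unit_norm_coord b a); rewrite -ab; ring.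
Qed.

Lemma rotK (z : int) v : rot R (- z) *m (rot R z *m v) = v.
Proof.
rewrite mulmxA -[RHS]mul1mx; congr (_ *m _); apply/matrixP => i j.
rewrite !mxE big_ord_recl big_ord1 !mxE rmorphN mulrN mulNr cosN sinN.
set c := cos _; set s := sin _; have cs : c ^+ 2 + s ^+ 2 = 1 by exact: cos2Dsin2.
by case: (unliftP 0 i) => [i'|] ->; case: (unliftP 0 j) => [j'|] ->;
  rewrite ?(ord1 i') ?(ord1 j') /=; rewrite -1?cs; ring.
Qed.

(** In lattice coordinates the rotation is an integer matrix preserving x^2 + xy + y^2, which is why
    it maps bond directions to bond directions. *)
Lemma rot_right a b : rot R 1 *m lat a b = lat b (- a - b).
Proof.
apply/colP => i; rewrite mxE big_ord_recl big_ord1 !latE !mxE mulr1.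
rewrite cos_third_turn sin_third_turn.
have /(congr1 ( *%R b)) := @sqr_sqrtr R 3 (ler0n _ 3).
by case: (unliftP 0 i) => [i'|] ->; rewrite ?(ord1 i') /=; lra.
Qed.

Lemma rot_left a b : rot R (- 1) *m lat a b = lat (- a - b) a.
Proof.
have <- : rot R 1 *m lat (- a - b) a = lat a b by rewrite rot_right; congr lat; ring.
exact: rotK.
Qed.

Lemma bond_direction_rot (z : int) v :
  z = -1 \/ z = 1 -> bond_direction v -> bond_direction (rot R z *m v).
Proof.
move=> zE /bond_directionP[a [b [ab ->]]]; apply/bond_directionP.
case: zE => ->.
  exists (- a - b), a; rewrite rot_left; split; first by rewrite -ab; ring.
  by rewrite rmorphB rmorphN.
exists b, (- a - b); rewrite rot_right; split; first by rewrite -ab; ring.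
by rewrite rmorphB rmorphN.
Qed.

(** With p = x + l (y - x), the vector y - x has a coordinate equal to 1 or -1 while p - x has
    integer coordinates. So l is an integer in [0, 1], and p is an endpoint of the bond. *)
Lemma site_on_carrier (O : set 'cV[R]_2) p : sites p -> carrier O p -> O p.
Proof.
move=> /sitesP[m [n pE]] [x [y [Ox Oy [xs ys xy1] [l /= /andP[l0 l1] plE]]]].
have /bond_directionP[a [b [ab yxE]]] : bond_direction (y - x) by exists x, y.
have /sitesP[c [d pxE]] : sites (p - x) by apply: sitesB => //; exists m, n.
have : l *: (y - x) = p - x by rewrite -plE addrAC subrr add0r.
rewrite yxE pxE latZ => /lat_inj[la lb].
have [k lE] : exists k : int, l = k%:~R.
  have : a \in [:: -1; 0; 1] by exact: unit_norm_coord ab.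
  rewrite !inE => /or3P[] /eqP aE; move: la ab lb; rewrite aE.
  - by move=> la _ _; exists (- c); rewrite rmorphN /= -la; ring.
  - move=> _ ab; have /orP[/eqP->|/eqP->] : (b == -1) || (b == 1) by nia.
      by move=> lb; exists (- d); rewrite rmorphN /= -lb; ring.
    by move=> lb; exists d; rewrite -lb; ring.
  - by move=> la _ _; exists c; rewrite -la; ring.
move: l0 l1 plE; rewrite lE -[0]/(0%:~R) -[1]/(1%:~R) !ler_int => k0 k1.
have /orP[/eqP->|/eqP->] : (k == 0) || (k == 1) by lia.
  by rewrite scale0r addr0 => <-.
by rewrite scale1r addrC subrK => <-.
Qed.

End TriangularLattice.

(** * The clock of scattering times *)

Section Dynamics.
Variables (R : realType) (N : nat) (dt : 'I_N.+1 -> R).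
Variables (I : initial_condition R N) (M : motion R N).
Hypotheses (dtP : displacements dt) (IP : admissible dt I).
Hypotheses (M0 : starts_at I M) (MP : evolves dt M).

Implicit Types (t p : int) (k : 'I_N.+1) (i j : 'I_N) (u : R).

Local Notation before j := (widen_ord (leqnSn N) j).
Local Notation after j := (lift ord0 j).

Definition tick t k : R := t%:~R + dt k.

Lemma dt_ord0 : dt ord0 = 0. Proof. by case: dtP. Qed.

Lemma dt_ord_max : dt ord_max = 1. Proof. by case: dtP. Qed.

Lemma dt_itv k : 0 <= dt k <= 1.
Proof.
have [dt0 dt_lt dt1] := dtP; rewrite -dt0 -dt1; apply/andP; split.
  have [->//|k0] := eqVneq k ord0.
  by apply/ltW/dt_lt; rewrite lt0n.
have [->//|kN] := eqVneq k ord_max.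
by apply/ltW/dt_lt; rewrite ltn_neqAle kN -ltnS ltn_ord.
Qed.

Lemma tick_wrap t : tick t ord_max = tick (t + 1) ord0.
Proof. by rewrite /tick dt_ord0 dt_ord_max addr0 rmorphD. Qed.

Lemma tick_ord0 t : tick t ord0 = t%:~R.
Proof. by rewrite /tick dt_ord0 addr0. Qed.

Lemma ord_step_ind (P : 'I_N.+1 -> Prop) :
  P ord0 -> (forall j, P (before j) -> P (after j)) -> forall k, P k.
Proof.
move=> P0 PS [n]; elim: n => [|n IHn] ltnN.
  by rewrite (_ : Ordinal _ = ord0) //; apply: val_inj.
rewrite (_ : Ordinal _ = after (Ordinal (ltnN : (n < N)%N))); last exact: val_inj.
apply: PS; rewrite (_ : before _ = Ordinal (ltnW ltnN)) //; exact: val_inj.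
Qed.

(** Since the steps are equivalences, truth at one slot spreads over its time unit and then to all
    integers, in both directions. *)
Lemma clock_ind (P : int -> 'I_N.+1 -> Prop) t0 :
  (forall t j, P t (before j) <-> P t (after j)) ->
  (forall t, P t ord_max <-> P (t + 1) ord0) ->
  P t0 ord0 -> forall t k, P t k.
Proof.
move=> PS Pwrap P0.
have PE t k : P t k <-> P t ord0.
  by elim/ord_step_ind: k => // j <-; split=> /PS.
have Psucc t : P t ord0 <-> P (t + 1) ord0 by rewrite -Pwrap PE.
have Pfwd n : P (t0 + n%:Z) ord0.
  elim: n => [|n IHn]; first by rewrite addr0.
  by rewrite -addn1 PoszD addrA -Psucc.
have Pbwd n : P (t0 - n%:Z) ord0.
  elim: n => [|n IHn]; first by rewrite subr0.
  by rewrite Psucc -addn1 PoszD opprD addrA subrK.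
move=> t k; apply/PE; rewrite -(subrK t0 t) addrC.
by case: (t - t0) => n //; rewrite NegzE.
Qed.

Lemma slot_of_time u :
  exists t j, tick t (before j) <= u <= tick t (after j).
Proof.
have /andP[fl fl1] := floor_itv u; set t := Num.floor u in fl fl1.
(* The claim is proved with any slot in place of [ord_max]; at slot 0 its premise contradicts the
   choice of t as the floor of u. *)
suff : u < tick t ord_max -> exists j, tick t (before j) <= u <= tick t (after j).
  by rewrite tick_wrap tick_ord0 => /(_ fl1)[j uj]; exists t, j.
elim/ord_step_ind: ord_max => [|j IHj uj]; first by rewrite tick_ord0 ltNge fl.
have [/IHj//|ju] := ltP u (tick t (before j)).
by exists j; rewrite ju ltW.
Qed.

Lemma tick_step t j :
  let s := tick t (before j) in
  let s' := tick t (after j) in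
  [/\ forall i, vel M i s' =
        if j == i then rot R (conf M s (pos M i s)) *m vel M i s
        else vel M i s,
      forall i, pos M i s' =
        pos M i s + (dt (after j) - dt (before j)) *: vel M i s',
      forall h, sites h -> conf M s' h =
        if h == pos M j s then - conf M s h else conf M s h
    & forall i u, s <= u <= s' ->
        pos M i u = pos M i s + (u - s) *: vel M i s'].
Proof. exact: MP. Qed.

(** * Scatterings take place at lattice sites *)

(* The site that particle [i] is heading to at time [tick t k]: it is hit at
   time [t + dt i] if [k <= i], and at time [t + 1 + dt i] otherwise. *)
Definition target t k i : 'cV[R]_2 :=
  pos M i (tick t k) + (dt (before i) - dt k + (i < k)%:R) *: vel M i (tick t k).

(** Admissibility carried to any slot. Targets replace positions because a particle in flight is not
    at a site. *)
Definition on_lattice t k : Prop :=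
  [/\ forall i, bond_direction (vel M i (tick t k)),
      forall i, sites (target t k i)
    & forall h, sites h -> conf M (tick t k) h = -1 \/ conf M (tick t k) h = 1].

Lemma target_before t j : target t (before j) j = pos M j (tick t (before j)).
Proof. by rewrite /target ltnn subrr addr0 scale0r addr0. Qed.

(** In straight flight the elapsed time is exactly what the remaining time loses. For the scattered
    particle the indicator jumps from 0 to 1, which adds one full bond. *)
Lemma target_after t i j : target t (after j) i =
  if i == j then pos M j (tick t (before j)) + vel M j (tick t (after j))
  else target t (before j) i.
Proof.
have [velE posE _ _] := tick_step t j.
rewrite /target posE lift0 /= -addrA -scalerDl.
have [->|ij] := eqVneq i j.
  rewrite ltnSn; congr (_ + _); rewrite -[RHS]scale1r; congr (_ *: _).
  by rewrite mulr1n; ring.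
rewrite velE eq_sym (negPf ij) ltnS leq_eqVlt (negPf ij : i == j :> nat = false) /=.
by congr (_ + _ *: _); ring.
Qed.

(** Backwards, the scattering site is the new target of j minus its new velocity; then the old
    orientations follow by a sign change, and the old velocity by the opposite rotation. *)
Lemma on_lattice_step t j : on_lattice t (before j) <-> on_lattice t (after j).
Proof.
have [velE posE confE _] := tick_step t j.
split=> -[bv st cf]; have st' i := target_after t i j.
  have sj : sites (pos M j (tick t (before j))) by rewrite -target_before.
  have bv' i : bond_direction (vel M i (tick t (after j))).
    by rewrite velE; case: eqP => // <-; apply: bond_direction_rot; [exact: cf|].
  split=> // [i|h sh].
    rewrite st'; case: eqP => // _; apply: sitesD => //.
    exact: bond_direction_site.
  rewrite confE//; case: ifP => _; last exact: cf.
  by case: (cf h sh) => ->; rewrite ?opprK; [right|left].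
have sj : sites (pos M j (tick t (before j))).
  have := st j; rewrite st' eqxx => sjv.
  rewrite -[pos _ _ _](addrK (vel M j (tick t (after j)))).
  by apply: sitesB => //; exact: bond_direction_site.
have cf' h : sites h ->
    conf M (tick t (before j)) h = -1 \/ conf M (tick t (before j)) h = 1.
  move=> sh; have := cf h sh; rewrite confE//; case: ifP => // _ [|] /eqP.
    by rewrite eqr_opp => /eqP; right.
  by rewrite eqr_oppLR => /eqP; left.
split=> // i; last first.
  have [->|ij] := eqVneq i j; first by rewrite target_before.
  by have := st i; rewrite st' (negPf ij).
have := bv i; rewrite velE eq_sym; have [->|//] := eqVneq i j.
set c := conf _ _ _ => /(@bond_direction_rot _ (- c)); rewrite rotK; apply.
by case: (cf' _ sj); rewrite -/c => ->; rewrite ?opprK; [right|left].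
Qed.

Lemma motion_on_lattice t k : on_lattice t k.
Proof.
have [pM vM cM] := M0; have [bI sI cI] := IP.
move: t k; apply: (@clock_ind on_lattice 0) => [t j|t|].
- exact: on_lattice_step.
- rewrite /on_lattice /target tick_wrap dt_ord0 dt_ord_max.
  (* The end of a unit has displacement 1 and indicator 1, the start of the next has 0 and 0: the
     remaining flight time is the same. *)
  suff tE i : dt (before i) - 1 + (i < (ord_max : 'I_N.+1))%:R =
              dt (before i) - 0 + (i < (ord0 : 'I_N.+1))%:R.
    by split=> -[? st ?]; split=> // i; move: (st i); rewrite tE.
  by rewrite ltn_ord /=; ring.
- rewrite /on_lattice /target tick_ord0 dt_ord0.
  split=> [i|i|h sh]; rewrite ?vM ?cM//; last exact: cI.
  by rewrite pM /= subr0 addr0; exact: sI.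
Qed.

Lemma site_at_scattering t j : sites (pos M j (tick t (before j))).
Proof.
by have [_ st _] := motion_on_lattice t (before j); rewrite -target_before.
Qed.

Lemma free_flight t i k : (k <= i)%N ->
  vel M i (tick t k) = vel M i (tick t ord0) /\
  pos M i (tick t k) = pos M i (tick t ord0) + dt k *: vel M i (tick t ord0).
Proof.
elim/ord_step_ind: k => [_|j IHj]; first by rewrite dt_ord0 scale0r addr0.
rewrite lift0 => ji; have [velE posE _ _] := tick_step t j.
have [vj rj] := IHj (ltnW ji).
have v_after : vel M i (tick t (after j)) = vel M i (tick t ord0).
  by rewrite velE (_ : j == i = false) //; apply/eqP => ij; rewrite ij ltnn in ji.
by rewrite posE v_after rj -addrA -scalerDl subrKC.
Qed.

Lemma conf_unvisited t h : sites h ->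
  (forall j, h <> pos M j (tick t (before j))) ->
  conf M (tick (t + 1) ord0) h = conf M (tick t ord0) h.
Proof.
move=> sh unvisited; rewrite -tick_wrap.
elim/ord_step_ind: ord_max => // j IHj.
have [_ _ -> //] := tick_step t j; by case: eqP => [/unvisited|].
Qed.

(** * Reversibility and periodicity *)

Definition agree p t k : Prop :=
  [/\ forall i, pos M i (tick (t + p) k) = pos M i (tick t k),
      forall i, vel M i (tick (t + p) k) = vel M i (tick t k)
    & forall h, sites h -> conf M (tick (t + p) k) h = conf M (tick t k) h].

(* Each step can be undone: the old positions come from the new velocities,
   then the old configuration from the old positions, and the old velocities
   from the old configuration. *)
Lemma agree_step p t j : agree p t (before j) <-> agree p t (after j).
Proof.
have sj := site_at_scattering t j.
have [velE posE confE _] := tick_step t j.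
have [velE' posE' confE' _] := tick_step (t + p) j.
split=> -[ps vs cs].
  have vs' i : vel M i (tick (t + p) (after j)) = vel M i (tick t (after j)).
    rewrite velE velE' ps vs; case: eqP => // ji.
    by rewrite cs // -ji.
  by split=> // [i|h sh]; rewrite ?posE ?posE' ?confE ?confE' ?vs' ?ps ?cs.
have ps' i : pos M i (tick (t + p) (before j)) = pos M i (tick t (before j)).
  have := ps i; rewrite posE posE' vs; exact: addIr.
have cs' h : sites h ->
    conf M (tick (t + p) (before j)) h = conf M (tick t (before j)) h.
  move=> sh; have := cs h sh; rewrite confE// confE'// ps'.
  by case: ifP => // _ /oppr_inj.
split=> // i; have := vs i; rewrite velE velE' ps'; case: eqP => // ji.
by rewrite cs' -?ji // => /(can_inj (@rotK R _)).
Qed.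

(** Agreement at one integer time spreads to all slots by [clock_ind]. Inside a slot the flight is
    determined by the position at its start and the velocity at its end, and both agree. *)
Lemma agree_periodic p t0 : agree p t0 ord0 ->
  forall i u, pos M i (u + p%:~R) = pos M i u.
Proof.
move=> agree0 i u.
have agreeP : forall t k, agree p t k.
  apply: clock_ind agree0 => [t j|t]; first exact: agree_step.
  by rewrite /agree !tick_wrap addrAC.
have tickD t k : tick (t + p) k = tick t k + p%:~R.
  by rewrite /tick rmorphD addrAC.
have [t [j uj]] := slot_of_time u.
have [_ _ _ /(_ i u uj) ->] := tick_step t j.
have [_ _ _ ->] := tick_step (t + p) j; last by rewrite !tickD !lerD2r.
have [-> _ _] := agreeP t (before j); have [_ -> _] := agreeP t (after j).
by rewrite tickD opprD addrACA subrr addr0.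
Qed.

(** * Recurrence of a confined system *)

(* Particle [i] is sampled when it hits a site, since its position at integer
   times need not be a site; [free_flight] recovers the latter. *)
Definition code (S V : seq 'cV[R]_2) t :=
  ([ffun i => (inord (index (pos M i (tick t (before i))) S) : 'I_(size S).+1,
               inord (index (vel M i (tick t ord0)) V) : 'I_(size V).+1)],
   [ffun m : 'I_(size S) => conf M (tick t ord0) (nth 0 S m) == 1]).

(** Velocities come first, as recovering a position at an integer time requires flying back along
    the velocity. One bit per site of S suffices because orientations are 1 or -1. *)
Lemma code_inj (S V : seq 'cV[R]_2) t t' :
  (forall v, bond_direction v -> v \in V) ->
  (forall i, pos M i (tick t (before i)) \in S) ->
  (forall i, pos M i (tick t' (before i)) \in S) ->
  (forall h, sites h -> h \notin S ->
     conf M (tick t ord0) h = conf M (tick t' ord0) h) ->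
  code S V t = code S V t' ->
  [/\ forall i, pos M i (tick t ord0) = pos M i (tick t' ord0),
      forall i, vel M i (tick t ord0) = vel M i (tick t' ord0)
    & forall h, sites h -> conf M (tick t ord0) h = conf M (tick t' ord0) h].
Proof.
move=> bdV tS tS' out codeE.
have /ffunP posvel : (code S V t).1 = (code S V t').1 by rewrite codeE.
have /ffunP confS : (code S V t).2 = (code S V t').2 by rewrite codeE.
have [bv _ cf] := motion_on_lattice t ord0.
have [bv' _ cf'] := motion_on_lattice t' ord0.
have velE i : vel M i (tick t ord0) = vel M i (tick t' ord0).
  have /(congr1 snd) := posvel i; rewrite !ffunE /=.
  by apply: inord_index_inj; exact: bdV.
split=> // [i|h sh].
  have /(congr1 fst) := posvel i; rewrite !ffunE /=.
  move=> /(inord_index_inj (tS i) (tS' i)).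
  have [_ ->] := @free_flight t i (before i) (leqnn _).
  have [_ ->] := @free_flight t' i (before i) (leqnn _).
  rewrite velE; exact: addIr.
have [hS|hS] := boolP (h \in S); last exact: out.
have ltS : (index h S < size S)%N by rewrite index_mem.
have := confS (Ordinal ltS); rewrite !ffunE /= nth_index //.
by case: (cf h sh) => ->; case: (cf' h sh) => ->.
Qed.

(** The enumeration [f] of integer times lets one argument serve both directions: [Posz] runs
    through 0, 1, 2, ... and [Negz] through -1, -2, .... Its injectivity makes the period
    nonzero. *)
Lemma confined_recurs (O : set 'cV[R]_2) (f : nat -> int) :
  injective f -> finite_set O ->
  (forall n i u, (f n)%:~R <= u <= (f n)%:~R + 1 -> carrier O (pos M i u)) ->
  (forall n h, sites h -> ~ O h -> conf M (tick (f n) ord0) h = conf M 0 h) ->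
  exists t p, p <> 0 /\ agree p t ord0.
Proof.
move=> f_inj /finite_seqP[S ->] fO out.
have [m [n [mn codeE]]] := pigeonhole (fun n => code S (directions R) (f n)).
exists (f n), (f m - f n); split; first by move/eqP; rewrite subr_eq0 => /eqP/f_inj.
rewrite /agree addrC subrK.
have fS l i : pos M i (tick (f l) (before i)) \in S.
  suff : [set` S] (pos M i (tick (f l) (before i))) by [].
  apply: site_on_carrier (site_at_scattering _ _) _; apply: (fO l).
  by have /andP[d0 d1] := dt_itv (before i); rewrite /tick lerDl d0 lerD2l.
apply: (code_inj (@mem_directions R) (fS m) (fS n)) codeE => h sh hS.
by rewrite !out //; exact/negP.
Qed.

(** For [D] a closed half-line at 0 this unfolds to the statement negated in [unbounded_future] or
    [unbounded_past]. *)
Definition confined (D : set R) i : Prop :=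
  exists O : set 'cV[R]_2, [/\ O `<=` @sites R, finite_set O
    & forall u, D u -> carrier O (pos M i u)].

Lemma confined_all (D : set R) : (forall i, confined D i) ->
  exists O : set 'cV[R]_2, finite_set O /\
    forall i u, D u -> carrier O (pos M i u).
Proof.
move=> /choice[O OP]; exists (\bigcup_(i in setT) O i); split.
  by apply: bigcup_finite => [|i _]; [exact: finite_finset|case: (OP i)].
move=> i u Du; have [_ _ /(_ _ Du)[x [y [xO yO xy seg]]]] := OP i.
by exists x, y; split=> //; exists i.
Qed.

(** A flip at h requires a particle hitting h during the unit, and a site hit on the carrier of O
    belongs to O. *)
Lemma conf_off_carrier (O : set 'cV[R]_2) t h : sites h -> ~ O h ->
  (forall i u, t%:~R <= u <= t%:~R + 1 -> carrier O (pos M i u)) ->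
  conf M (t + 1)%:~R h = conf M t%:~R h.
Proof.
move=> sh hO inO; rewrite -!tick_ord0; apply: conf_unvisited => // j hE.
apply: hO; rewrite hE; apply: site_on_carrier (site_at_scattering _ _) _.
by apply: inO; have /andP[d0 d1] := dt_itv (before j); rewrite /tick lerDl d0 lerD2l.
Qed.

Lemma confined_future_recurs : (forall i, confined [set u | 0 <= u] i) ->
  exists t p, p <> 0 /\ agree p t ord0.
Proof.
move=> /confined_all[O [Ofin inO]].
have inO' (n : nat) i u : n%:~R <= u <= n%:~R + 1 -> carrier O (pos M i u).
  by move=> /andP[nu _]; apply: inO; apply: le_trans nu; rewrite ler0z.
apply: (@confined_recurs O Posz) => // [m n []//|n h sh hO].
rewrite tick_ord0; elim: n => // n IHn.
by rewrite -addn1 PoszD (conf_off_carrier sh hO (inO' n)).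
Qed.

Lemma confined_past_recurs : (forall i, confined [set u | u <= 0] i) ->
  exists t p, p <> 0 /\ agree p t ord0.
Proof.
move=> /confined_all[O [Ofin inO]].
(* [Negz n] is -(n + 1), so the unit starting there ends at -n and stays in the past. *)
have inO' (n : nat) i u :
    (Negz n)%:~R <= u <= (Negz n)%:~R + 1 -> carrier O (pos M i u).
  move=> /andP[_ un]; apply: inO; apply: le_trans un _.
  by rewrite -[1]/(1%:~R) -intrD lerz0 NegzE; lia.
apply: (@confined_recurs O Negz) => // [m n []//|n h sh hO].
(* The induction runs backwards in time; its base compares times -1 and 0. *)
rewrite tick_ord0; elim: n => [|n IHn].
  by have := conf_off_carrier sh hO (inO' 0%N).
rewrite -IHn; have := conf_off_carrier sh hO (inO' n.+1).
by rewrite !NegzE -addn1 PoszD opprD subrK.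
Qed.

(** * Transfer between past and future *)

(** The pigeonhole leaves the sign of p unknown, whence the absolute value. *)
Lemma period_shift p t i u (n : nat) : agree p t ord0 ->
  pos M i (u + `|p|%:~R * n%:R) = pos M i u.
Proof.
move=> /agree_periodic per.
have perN w : pos M i (w + `|p|%:~R) = pos M i w.
  case: (ger0P p) => [p0|p0]; first exact: per.
  by rewrite -(per i (w + _)) rmorphN subrK.
elim: n => [|n IHn]; first by rewrite mulr0 addr0.
by rewrite -natr1 mulrDr mulr1 addrA perN.
Qed.

Lemma period_reaches p u : p <> 0 -> exists n : nat, `|u| <= `|p|%:~R * n%:R.
Proof.
move=> /eqP p0; exists (Num.truncn `|u|).+1.
apply: le_trans (ltW (truncnS_gt _)) _.
by rewrite ler_peMl // -[1]/(1%:~R) ler_int -gtz0_ge1 normr_gt0.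
Qed.

(** Adding enough periods moves a past time into the future without changing the position, so the
    same set O works. *)
Lemma recurs_confined_past p t i : p <> 0 -> agree p t ord0 ->
  confined [set u | 0 <= u] i -> confined [set u | u <= 0] i.
Proof.
move=> p0 per [O [Os Ofin inO]]; exists O; split=> // u /= u0.
have [n un] := period_reaches u p0.
rewrite -(period_shift i u n per); apply: inO => /=.
by move: un; rewrite ler0_norm//; lra.
Qed.

Lemma recurs_confined_future p t i : p <> 0 -> agree p t ord0 ->
  confined [set u | u <= 0] i -> confined [set u | 0 <= u] i.
Proof.
move=> p0 per [O [Os Ofin inO]]; exists O; split=> // u /= u0.
have [n un] := period_reaches u p0.
rewrite -[u](subrK (`|p|%:~R * n%:R)) (period_shift i _ n per); apply: inO => /=.
by move: un; rewrite ger0_norm//; lra.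
Qed.

End Dynamics.

Theorem theorem3 (R : realType) (N : nat) (dt : 'I_N.+1 -> R)
    (I : initial_condition R N) (M : motion R N) :
  (1 <= N)%N ->
  displacements dt ->
  admissible dt I ->
  starts_at I M ->
  evolves dt M ->
  ((exists i, unbounded_past M i) -> exists k, unbounded_future M k) /\
  ((exists i, unbounded_future M i) -> exists k, unbounded_past M k).
Proof.
move=> _ dtP IP M0 MP; split=> -[i unb]; apply: contrapT => /forallNP bnd.
  have fut k : confined M [set u | 0 <= u] k by exact: contrapT (bnd k).
  have [t [p [p0 per]]] := confined_future_recurs dtP IP M0 MP fut.
  exact/unb/(recurs_confined_past dtP IP M0 MP p0 per).
have past k : confined M [set u | u <= 0] k by exact: contrapT (bnd k).
have [t [p [p0 per]]] := confined_past_recurs dtP IP M0 MP past.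
exact/unb/(recurs_confined_future dtP IP M0 MP p0 per).
Qed.
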